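(* The outgrows of the Losev-Manin compactification $\bar F_n$ of $F_n\cong\mathcal{M}_{0,n}$ can be divided into two sets such that: (i) those from the first set give the completion, that is, the extension, of $F_n$ to the orbit $(\mathbb{C}^* )^{n-3}\cdot\mathbf{c}$ for $\mathbf{c}\in F_n$, and they contain the points having at least one coordinate $(1:1)$ and do not contain the coordinate $(1:0)$ or $(0:1)$; (ii) those from the second set give the toric compactification of $(\mathbb{C}^* )^{n-3}\cdot\mathbf{c}$ to $\bar F_n$, and they contain the points having at least one coordinate $(1:0)$ or $(0:1)$.
   Context: Let $n\ge4$, $N=\binom{n-2}{2}$ and $$\bar F_n=\{((c_{ij}:c'_{ij}))_{3\le i<j\le n}\in(\mathbb{C}P^1)^N : c_{ij}c'_{ik}c_{jk}=c'_{ij}c_{ik}c'_{jk}\ \text{for all } 3\le i<j<k\le n\}.$$ $F_n\subset\bar F_n$ is the subset of points all of whose coordinates $(c_{ij}:c'_{ij})$ are different from $(1:0),(0:1),(1:1)$; $F_n\cong\mathcal{M}_{0,n}$, and $\bar F_n$, which is isomorphic to the Losev-Manin space $\overline{L}_{0,n,2}$, is the closure of $F_n$ in $(\mathbb{C}P^1)^N$ (the Losev-Manin compactification of $F_n$). The torus $(\mathbb{C}^* )^{n-3}$ acts on $\bar F_n$ by $\mathbf{t}\cdot((c_{ij}:c'_{ij}))=((\rho_{ij}(\mathbf{t})c_{ij}:c'_{ij}))$, where $\rho_{3k}(\mathbf{t})=t_{k-3}$ for $4\le k\le n$ and $\rho_{ij}(\mathbf{t})=t_{j-3}/t_{i-3}$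 for $4\le i<j\le n$; for $\mathbf{c}\in F_n$ the orbit $(\mathbb{C}^* )^{n-3}\cdot\mathbf{c}$ contains $F_n$ and its closure in $(\mathbb{C}P^1)^N$ is $\bar F_n$ (the toric compactification of the orbit). The outgrows of the Losev-Manin compactification are the strata making up $\bar F_n\setminus F_n$, determined by prescribing which coordinates $(c_{ij}:c'_{ij})$ are equal to $(1:0)$, to $(0:1)$ and to $(1:1)$. *)

(* Defs.v *)
From HB Require Import structures.
From mathcomp Require Import all_boot all_order all_algebra.
From mathcomp Require Import all_classical all_reals.
From mathcomp Require Import topology normedtype.
From mathcomp.real_closed Require Import complex.

Set Implicit Arguments.
Unset Strict Implicit.
Unset Printing Implicit Defensive.

Import Order.TTheory GRing.Theory Num.Theory.
Import numFieldNormedType.Exports.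

Local Open Scope classical_set_scope.
Local Open Scope ring_scope.
Local Open Scope quotient_scope.

(* The topology of a numFieldType (distance `|x - y|) is keyed on abstract
   structures, hence this name for R[i] instead of a mere notation. *)
Definition Cfield (R : realType) : numClosedFieldType := R[i].

Section ProjectiveLine.
Variable R : realType.
Local Notation C := (Cfield R).

Definition nzset : set (C * C) := [set v | v != (0, 0)].
Definition nzvec : Type := nzset.
HB.instance Definition _ := Topological.on nzvec.
HB.instance Definition _ := SubType.on nzvec.

Definition proportional : rel nzvec := fun u v =>
  `[< exists2 lam : C,
        lam != 0 & \val v = (lam * (\val u).1, lam * (\val u).2) >].

Lemma proportional_equiv : equiv_class_of proportional.
Proof.
split.
- by move=> u; apply/asboolP; exists 1; rewrite ?oner_neq0// !mul1r -surjective_pairing.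
- have sym u v : proportional u v -> proportional v u.
    move=> /asboolP[l l0 e]; apply/asboolP; exists l^-1; rewrite ?invr_eq0//.
    by rewrite e /= !mulKf// -surjective_pairing.
  by move=> u v; apply/idP/idP; exact: sym.
- move=> v u w /asboolP[l l0 e] /asboolP[m m0 f]; apply/asboolP.
  by exists (m * l); rewrite ?mulf_neq0// f e /= !mulrA.
Qed.

Canonical proportional_equivRel := EquivRelPack proportional_equiv.

Definition CP1 : Type := quotient_topology {eq_quot proportional}.
HB.instance Definition _ := Topological.on CP1.
HB.instance Definition _ := Quotient.on CP1.

Lemma nz10_subproof : ((1, 0) : C * C) \in nzset.
Proof. by rewrite inE /nzset /= xpair_eqE oner_eq0. Qed.

(* hpt a b is the point (a : b); the junk value hpt 0 0 is (1 : 0). *)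
Definition hpt (a b : C) : CP1 :=
  \pi_CP1 (insubd (exist _ (1, 0) nz10_subproof : nzvec) (a, b)).

(* A chosen pair (hx x : hy x) of homogeneous coordinates of x. *)
Definition hx (x : CP1) : C := (\val (repr x : nzvec)).1.
Definition hy (x : CP1) : C := (\val (repr x : nzvec)).2.

(* (c : c') |-> (a c : c'), meaningful for a != 0. *)
Definition scaleP1 (a : C) (x : CP1) : CP1 := hpt (a * hx x) (hy x).

Lemma val_hpt a b : (a, b) != (0, 0) ->
  \val (insubd (exist _ (1, 0) nz10_subproof : nzvec) (a, b)) = (a, b).
Proof. by move=> ab0; apply: insubdK; rewrite inE. Qed.

Lemma hxy_neq0 (x : CP1) : (hx x, hy x) != (0, 0).
Proof. by rewrite -surjective_pairing; have := valP (repr x : nzvec); rewrite inE. Qed.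

Lemma hptK (x : CP1) : hpt (hx x) (hy x) = x.
Proof.
rewrite -[RHS]reprK /hpt; congr (\pi_CP1 _); apply: val_inj.
by rewrite val_hpt ?hxy_neq0// -surjective_pairing.
Qed.

Lemma hpt_eq (a b c d : C) : (a, b) != (0, 0) -> (c, d) != (0, 0) ->
  hpt a b = hpt c d <->
  exists2 lam : C, lam != 0 & (c, d) = (lam * a, lam * b).
Proof.
move=> ab0 cd0; split.
  move=> /(@eqquotP _ _ {eq_quot proportional} _ _)/asboolP[lam lam0].
  by rewrite !val_hpt//; exists lam.
move=> [lam lam0 e]; apply/(@eqquotP _ _ {eq_quot proportional} _ _).
by apply/asboolP; exists lam; rewrite // !val_hpt.
Qed.

Lemma hxy_hpt (a b : C) : (a, b) != (0, 0) ->
  exists2 lam : C, lam != 0 & (hx (hpt a b), hy (hpt a b)) = (lam * a, lam * b).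
Proof. by move=> ab0; apply/hpt_eq; rewrite ?hxy_neq0 ?hptK. Qed.

Lemma scaleP1_hpt (t a b : C) : t != 0 -> (a, b) != (0, 0) ->
  scaleP1 t (hpt a b) = hpt (t * a) b.
Proof.
move=> t0 ab0; have [lam lam0 [ex ey]] := hxy_hpt ab0.
have tab0 : (t * a, b) != (0, 0).
  by move: ab0; rewrite !xpair_eqE mulf_eq0 (negPf t0).
rewrite /scaleP1 ex ey; apply/esym/hpt_eq => //; last first.
  by exists lam; rewrite // mulrCA.
by move: tab0; rewrite mulrCA !xpair_eqE !mulf_eq0 (negPf lam0).
Qed.

Lemma open_CP1 (U : set CP1) : open U <-> open (\pi_CP1 @^-1` U : set nzvec).
Proof. by []. Qed.

End ProjectiveLine.

Section Strata.
Variables (R : realType) (n : nat).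
Local Notation C := (Cfield R).

(* The N = 'C(n - 2, 2) pairs 3 <= i < j <= n. *)
Definition idx : Type := {p : 'I_n.+1 * 'I_n.+1 | (3 <= p.1 < p.2)%N}.
HB.instance Definition _ := Finite.on idx.

Definition Idx (i j : 'I_n.+1) (hij : (3 <= i < j)%N) : idx := exist _ (i, j) hij.

(* (CP^1)^N with the product topology. *)
Definition CP1N : topologicalType := prod_topology (fun _ : idx => CP1 R).

(* The equations are homogeneous in each pair (c : c'), so the choice of
   homogeneous coordinates is immaterial. *)
Definition Fnbar : set CP1N := [set c : CP1N |
  forall (i j k : 'I_n.+1)
    (hij : (3 <= i < j)%N) (hik : (3 <= i < k)%N) (hjk : (3 <= j < k)%N),
    hx (c (Idx hij)) * hy (c (Idx hik)) * hx (c (Idx hjk)) =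
    hy (c (Idx hij)) * hx (c (Idx hik)) * hy (c (Idx hjk))].

Definition Fn : set CP1N := [set c | Fnbar c /\
  forall p, [/\ c p <> hpt 1 0, c p <> hpt 0 1 & c p <> hpt 1 1]].

Definition torus : set ((n - 3).-tuple C) := [set t | forall k, tnth t k != 0].

(* The coordinate t_k, 1 <= k <= n - 3, is entry k - 1 of the tuple. *)
Definition tcoord (t : (n - 3).-tuple C) (k : nat) : C := t`_k.-1.

Definition rho (t : (n - 3).-tuple C) (p : idx) : C :=
  let: (i, j) := \val p in
  if (i == 3 :> nat)%N then tcoord t (j - 3)
  else tcoord t (j - 3) / tcoord t (i - 3).

Definition torus_act (t : (n - 3).-tuple C) (c : CP1N) : CP1N :=
  fun p => scaleP1 (rho t p) (c p).

Definition torus_orbit (c : CP1N) : set CP1N := [set torus_act t c | t in torus].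

Definition stratum (A10 A01 A11 : set idx) : set CP1N := [set c | Fnbar c /\
  [/\ [set p | c p = hpt 1 0] = A10,
      [set p | c p = hpt 0 1] = A01 &
      [set p | c p = hpt 1 1] = A11]].

Definition outgrows : set (set CP1N) := [set S |
  [/\ exists A10 A01 A11, S = stratum A10 A01 A11,
      S !=set0 & S `<=` Fnbar `\` Fn]].

End Strata.

Arguments Fnbar : clear implicits.
Arguments Fn : clear implicits.
Arguments outgrows : clear implicits.

Lemma card_idx (n : nat) : #|{: idx n}| = 'C(n - 2, 2).
Proof.
have sumB3 m : (\sum_(j < m.+1) (j - 3) = 'C(m - 2, 2))%N.
  elim: m => [|m IHm]; first by rewrite big_ord_recr big_ord0.
  rewrite big_ord_recr /= IHm; case: m {IHm} => [|[|m]] //.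
  by rewrite !subSS !subn0 binS bin1 addnC.
rewrite card_sig -sumB3 -sum1_card.
rewrite -(pair_big_dep xpredT (fun i j : 'I_n.+1 => (3 <= i < j)%N)
  (fun _ _ => 1%N)) /=.
rewrite (exchange_big_dep xpredT) //=; apply: eq_bigr => j _.
rewrite -[RHS]muln1 -sum_nat_const_nat big_geq_mkord.
rewrite (big_ord_widen_cond n.+1 (fun i => 3 <= i)%N (fun=> 1%N)) //.
exact: ltnW.
Qed.

(* Main.v *)
(* For [c] in [F_n] the orbit of [c] is the set of points of [Fnbar] without
   coordinate (1:0) or (0:1): the torus parameter moving [c] to [x] is
   read off the coordinates [3k], and the equations of [Fnbar] determine the
   other ones.  [Fnbar] is closed because its equations are multihomogeneous and
   the projection onto the projective line is open.  The orbit is dense in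
   [Fnbar]: writing x_ij = c_ij / c'_ij, the equations say that
   x_ij x_jk = x_ik, so "x_ij = 0" defines levels [l] on the indices, and [x] is
   the limit as s -> 0 of the points x_ij = (a_j s^(l_j)) / (a_i s^(l_i)).
   Finally, a stratum lies either inside the orbit or in its complement. *)
Require Import Defs.
From mathcomp Require Import all_boot all_order all_algebra.
From mathcomp Require Import all_classical all_reals.
From mathcomp Require Import topology normedtype.
From mathcomp Require Import zify ring.

Local Open Scope classical_set_scope.

(** * Vanishing levels of a multiplicative cocycle *)

Section Levels.
Local Open Scope ring_scope.
Import GRing.Theory.
Variables (I : finType) (F : fieldType) (A : I -> I -> F).
Hypothesis A_neq0 : forall i j, (A i j != 0) || (A j i != 0).
Hypothesis A_cocycle :
  forall i j k, A i j * A j k * A k i = A j i * A k j * A i k.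

Let Aii i : A i i != 0.
Proof. by have := A_neq0 i i; rewrite orbb. Qed.

Lemma cocycle_neq0_trans j i k : A i j != 0 -> A j k != 0 -> A i k != 0.
Proof.
move=> ij jk; apply/negP => /eqP ik0.
have := A_neq0 i k; rewrite ik0 eqxx /= => ki.
have /esym/eqP := A_cocycle i j k; rewrite ik0 mulr0 eq_sym !mulf_eq0.
by rewrite (negPf ij) (negPf jk) (negPf ki).
Qed.

(* [A i j = 0] is a strict weak order on the indices; [level i] counts the
   predecessors of [i]. *)
Let level i := #|[pred k | A k i == 0]|.

Let level_lt i j : (level i < level j)%N = (A i j == 0).
Proof.
have sub i' j' : A i' j' != 0 -> (level j' <= level i')%N.
  move=> ij; apply/subset_leq_card/fintype.subsetP => k; rewrite !inE.
  by apply: contraTT => ki; exact: cocycle_neq0_trans ki ij.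
apply/idP/idP => [|/eqP ij0].
  by apply: contraTT => /sub; rewrite -leqNgt.
have ji : A j i != 0 by have := A_neq0 i j; rewrite ij0 eqxx.
(* Predecessors of [i] precede [j]; the inclusion is strict because [i] precedes [j] but not
   itself. *)
apply/proper_card/properP; split.
  apply/fintype.subsetP => k; rewrite !inE; apply: contraTT => kj.
  exact: cocycle_neq0_trans kj ji.
by exists i; rewrite !inE ?ij0 // Aii.
Qed.

(* The subtraction is truncated: [0 ^+ (l i - l j)] is 1 if [l i <= l j] and 0
   otherwise. *)
Lemma cocycle_levels : exists (l : I -> nat) (a : I -> F),
  (forall i, a i != 0) /\
  forall i j,
    A i j * (a i * 0 ^+ (l i - l j)) = A j i * (a j * 0 ^+ (l j - l i)).
Proof.
pose E i k := (A i k != 0) && (A k i != 0).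
(* [r] is constant on indices of equal level. *)
pose r i := odflt i [pick k | E i k].
have rE i : E i (r i).
  by rewrite /r; case: pickP => //= /(_ i); rewrite /E Aii.
(* [a i] compares [i] with a reference index of its own level, so both factors of the quotient are
   nonzero. *)
exists level, (fun i => A (r i) i / A i (r i)); split=> [i|i j].
  by have /andP[? ?] := rE i; rewrite mulf_neq0 // invr_eq0.
have [lt_ij|lt_ji|eq_ij] := ltngtP (level i) (level j).
(* At different levels both sides vanish: one through [A], the other through a positive power of
   0. *)
- have /eqP -> : A i j == 0 by rewrite -level_lt.
  by rewrite mul0r expr0n subn_eq0 leqNgt lt_ij /= !mulr0.
- have /eqP -> : A j i == 0 by rewrite -level_lt.
  by rewrite mul0r expr0n subn_eq0 leqNgt lt_ji /= !mulr0.
have ij : A i j != 0 by rewrite -level_lt eq_ij ltnn.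
have ji : A j i != 0 by rewrite -level_lt eq_ij ltnn.
have -> : r i = r j.
  rewrite /r (eq_pick (Q := E j)); last first.
    move=> k; rewrite /E; apply/andP/andP => -[h1 h2]; split;
    by [exact: cocycle_neq0_trans h1 | exact: cocycle_neq0_trans h2 _
       |exact: cocycle_neq0_trans ij h1| exact: cocycle_neq0_trans ji h1
       |exact: cocycle_neq0_trans h2 ij| exact: cocycle_neq0_trans h2 ji].
  by case: pickP => //= /(_ j); rewrite /E Aii.
have /andP[jr rj] := rE j; set k := r j in jr rj *.
have ik := cocycle_neq0_trans _ _ _ ij jr.
rewrite eq_ij subnn expr0 !mulr1 !mulrA.
(* Cleared of denominators, this is the cocycle identity for [i], [j], [k]. *)
by apply/eqP; rewrite eqr_div // mulrAC A_cocycle.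
Qed.
End Levels.

(** * Convergence in products and the topology of the projective line *)

Lemma cvg_prod_topology (I : choiceType) (K : I -> topologicalType) (T : Type)
    (G : set_system T) (f : T -> prod_topology K) (x : prod_topology K) :
  Filter G -> (forall i, f t i @[t --> G] --> x i) -> f @ G --> x.
Proof.
(* The product topology is the supremum of the initial topologies of the projections, so coordinates
   can be treated one at a time. *)
move=> FG fx; apply/cvg_sup => i A /=.
have /= -> := @nbhsE (initial_topology (fun g : forall i, K i => g i)) x.
move=> [_ [[B oB <-] Bx] BA]; apply: (filterS BA).
exact: fx (open_nbhs_nbhs (conj oB Bx)).
Qed.

Section CrossProduct.
Local Open Scope ring_scope.
Import GRing.Theory.

Lemma cross_proportional (F : fieldType) (a b c d : F) :
  (a, b) != (0, 0) -> (c, d) != (0, 0) -> a * d = b * c ->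
  exists2 l : F, l != 0 & (c, d) = (l * a, l * b).
Proof.
move=> ab cd e.
have [a0|a0] := eqVneq a 0.
  move: ab e; rewrite a0 xpair_eqE eqxx /= mul0r => b0 /esym/eqP.
  rewrite mulf_eq0 (negPf b0) /= => /eqP c0.
  move: cd; rewrite c0 xpair_eqE eqxx /= => d0.
  by exists (d / b); rewrite ?mulf_neq0 ?invr_eq0 // mulr0 divfK.
have c0 : c != 0.
  apply: contraNneq cd => c0; move: e; rewrite c0 mulr0 => /eqP.
  by rewrite mulf_eq0 (negPf a0) /= => /eqP ->.
exists (c / a); rewrite ?mulf_neq0 ?invr_eq0 // divfK //; congr (_, _).
by rewrite mulrAC mulrC [c * b]mulrC -e mulKf.
Qed.

End CrossProduct.

Section ProjectiveLine.
Local Open Scope ring_scope.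
Import GRing.Theory Num.Theory.
Import numFieldNormedType.Exports.
Variable R : realType.
Local Notation C := (Cfield R).
Implicit Types (a b c d : C) (x : CP1 R).

Lemma hpt_cross a b c d : (a, b) != (0, 0) -> (c, d) != (0, 0) ->
  hpt a b = hpt c d <-> a * d = b * c.
Proof.
move=> ab cd; split; first by case/(hpt_eq ab cd) => l l0 [-> ->]; ring.
move=> e; apply/(hpt_eq ab cd).
exact: cross_proportional.
Qed.

Lemma hpt_hx x a b : (a, b) != (0, 0) ->
  hpt a b = x <-> a * hy x = b * hx x.
Proof. by move=> ab; rewrite -{1}(hptK x); exact/hpt_cross/hxy_neq0. Qed.

Lemma hy_eq0 x : x = hpt 1 0 <-> hy x = 0.
Proof.
have p : ((1, 0) : C * C) != (0, 0) by rewrite xpair_eqE oner_eq0.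
have := hpt_hx x _ _ p; rewrite mul1r mul0r => <-; split=> ->//.
Qed.

Lemma hx_eq0 x : x = hpt 0 1 <-> hx x = 0.
Proof.
have p : ((0, 1) : C * C) != (0, 0) by rewrite xpair_eqE oner_eq0 andbF.
have := hpt_hx x _ _ p; rewrite mul1r mul0r => e.
by split=> [/esym/e|/esym/e] ->.
Qed.

Lemma open_nzvec (U : set (nzvec R)) :
  open U <-> exists2 V : set (C * C), open V & U = \val @^-1` V.
Proof. by split=> [[V oV <-]|[V oV ->]]; exists V. Qed.

(** The quotient map is continuous on nonzero vectors. One of the two limits is nonzero, so the
    pairs are eventually nonzero and the junk value of [hpt] is avoided. *)
Lemma hpt_cvg (T : Type) (G : set_system T) (f g : T -> C) a b :
  Filter G -> (a, b) != (0, 0) -> f @ G --> a -> g @ G --> b ->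
  hpt (f t) (g t) @[t --> G] --> hpt a b.
Proof.
move=> FG ab fa gb W; rewrite nbhsE => -[U [oU Uab] UW].
have /open_nzvec[V oV UV] := (open_CP1 U).1 oU.
have Vab : V (a, b).
  move: Uab; rewrite /hpt -[U _]/((\pi_(CP1 R) @^-1` U) _)%qT UV /=.
  by rewrite val_hpt.
have fg : (f t, g t) @[t --> G] --> (a, b) by exact: cvg_pair fa gb.
have nz : \forall t \near G, (f t, g t) != (0, 0).
  move: ab; rewrite xpair_eqE negb_and => /orP[a0|b0].
    apply: filterS (cvgr_neq0 _ fa a0) => t ft.
    by rewrite xpair_eqE negb_and ft.
  apply: filterS (cvgr_neq0 _ gb b0) => t gt.
  by rewrite xpair_eqE negb_and gt orbT.
apply: filterS2 nz (fg _ (open_nbhs_nbhs (conj oV Vab))) => t nzt Vt.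
by apply: UW; rewrite /hpt -[U _]/((\pi_(CP1 R) @^-1` U) _)%qT UV /= val_hpt.
Qed.

(** The saturation of an open set under scaling is a union of preimages of it under the dilations by
    nonzero [l], each of which is open. *)
Lemma open_hpt (V : set (C * C)) : open V ->
  open [set x | exists2 v : C * C, V v /\ v != (0, 0) & x = hpt v.1 v.2].
Proof.
move=> oV; apply/open_CP1/open_nzvec.
pose W (l : C) : set (C * C) := (fun v : C * C => (l * v.1, l * v.2)) @^-1` V.
exists (\bigcup_(l in [set l | l != 0]) W l).
  apply: bigcup_open => l _; apply: open_comp oV => v _.
  have h1 : l * w.1 @[w --> v] --> l * v.1.
    by apply: cvgM; [exact: cvg_cst|exact: cvg_fst].
  have h2 : l * w.2 @[w --> v] --> l * v.2.
    by apply: cvgM; [exact: cvg_cst|exact: cvg_snd].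
  exact: cvg_pair h1 h2.
have u_neq0 (u : nzvec R) : ((\val u).1, (\val u).2) != (0, 0).
  by rewrite -surjective_pairing //; have := valP u; rewrite inE.
have hptE (u : nzvec R) : (\pi_(CP1 R) u)%qT = hpt (\val u).1 (\val u).2.
  rewrite /hpt; congr (\pi_(CP1 R) _)%qT; apply: val_inj.
  by rewrite val_hpt // -surjective_pairing.
apply/seteqP; split=> u.
  move=> [[a b] [Vab ab0] /=]; rewrite hptE => /hpt_eq.
  by move=> /(_ (u_neq0 u) ab0)[l l0 e]; exists l => //; rewrite /W /= -e.
move=> [l l0 Vl]; rewrite /mkset in l0.
have lu_neq0 : (l * (\val u).1, l * (\val u).2) != (0, 0).
  by have := u_neq0 u; rewrite !xpair_eqE !mulf_eq0 (negPf l0).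
exists (l * (\val u).1, l * (\val u).2) => //.
rewrite hptE; apply/hpt_cross => //.
by rewrite [LHS]mulrC [LHS]mulrAC [LHS]mulrC.
Qed.
End ProjectiveLine.

(** * The equations of [Fnbar] and its closedness *)

Section Scale.
Local Open Scope ring_scope.
Import GRing.Theory.

(** Both sides are homogeneous of degree one in each pair, hence pick up the common factor
    [l1 * l2 * l3]. *)
Lemma cocycle_scale (F : fieldType) (l1 l2 l3 a1 a2 a3 b1 b2 b3 : F) :
  l1 != 0 -> l2 != 0 -> l3 != 0 ->
  (l1 * a1) * (l2 * b2) * (l3 * a3) = (l1 * b1) * (l2 * a2) * (l3 * b3) <->
  a1 * b2 * a3 = b1 * a2 * b3.
Proof.
move=> l1_neq0 l2_neq0 l3_neq0.
have l_neq0 : l1 * l2 * l3 != 0 by rewrite !mulf_neq0.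
by split=> [h|h]; [apply: (mulfI l_neq0); ring: h|ring: h].
Qed.

End Scale.

Section Fnbar.
Local Open Scope ring_scope.
Import GRing.Theory Num.Theory.
Import numFieldNormedType.Exports.
Variables (R : realType) (n : nat).
Local Notation C := (Cfield R).
Local Notation idx := (idx n).
Local Notation CP1N := (CP1N R n).
Implicit Types (x c : CP1N).

(** Allows the equations to be tested on any homogeneous coordinates instead of the chosen ones
    [hx], [hy]. *)
Lemma Fnbar_hpt (x : CP1N) (f g : idx -> C) :
  (forall p, (f p, g p) != (0, 0)) -> (forall p, x p = hpt (f p) (g p)) ->
  Fnbar R n x <->
  forall (i j k : 'I_n.+1)
    (hij : (3 <= i < j)%N) (hik : (3 <= i < k)%N) (hjk : (3 <= j < k)%N),
    f (Idx hij) * g (Idx hik) * f (Idx hjk) =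
    g (Idx hij) * f (Idx hik) * g (Idx hjk).
Proof.
move=> fg xE.
have lE p : exists2 l : C, l != 0 & (hx (x p), hy (x p)) = (l * f p, l * g p).
  by rewrite xE; exact: hxy_hpt.
split=> e i j k hij hik hjk; have := e i j k hij hik hjk;
  have [l1 l1_neq0 [-> ->]] := lE (Idx hij);
  have [l2 l2_neq0 [-> ->]] := lE (Idx hik);
  have [l3 l3_neq0 [-> ->]] := lE (Idx hjk);
  by apply cocycle_scale.
Qed.

Lemma nbhs_CP1 (y : CP1 R) (V : set (C * C)) : nbhs (hx y, hy y) V ->
  nbhs y [set z | exists2 v : C * C, V v /\ v != (0, 0) & z = hpt v.1 v.2].
Proof.
rewrite nbhsE => -[U [oU Uy] UV]; have oW := open_hpt R U oU.
have Wy : [set z | exists2 v : C * C, U v /\ v != (0, 0) & z = hpt v.1 v.2] y.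
  by exists (hx y, hy y); rewrite ?hptK //=; split=> //; exact: hxy_neq0.
apply: filterS (open_nbhs_nbhs (conj oW Wy)) => z [v [Uv v0] ->].
by exists v => //; split=> //; exact: UV.
Qed.

(** An equation failing at [x] fails for all representatives near the chosen ones. Since the
    projection is open, these cover a neighbourhood of [x], which would have to contain a point of
    [Fnbar]. *)
Lemma closed_Fnbar : closed (Fnbar R n).
Proof.
move=> x xcl i j k hij hik hjk; apply/eqP.
rewrite -subr_eq0; apply/negP => /negP neq.
pose v p : C * C := (hx (x p), hy (x p)).
pose P (z : (C * C) * (C * C) * (C * C)) : C :=
  z.1.1.1 * z.1.2.2 * z.2.1 - z.1.1.2 * z.1.2.1 * z.2.2.
pose z0 := (v (Idx hij), v (Idx hik), v (Idx hjk)).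
have Pz0 : P z @[z --> z0] --> P z0.
  apply: cvgB; repeat (apply: cvgM).
  exact: cvg_comp _ _ (cvg_comp _ _ cvg_fst cvg_fst) cvg_fst.
  exact: cvg_comp _ _ (cvg_comp _ _ cvg_fst cvg_snd) cvg_snd.
  exact: cvg_comp _ _ cvg_snd cvg_fst.
  exact: cvg_comp _ _ (cvg_comp _ _ cvg_fst cvg_fst) cvg_snd.
  exact: cvg_comp _ _ (cvg_comp _ _ cvg_fst cvg_snd) cvg_fst.
  exact: cvg_comp _ _ cvg_snd cvg_snd.
(* [P] is nonzero near [z0]; the neighbourhood is shrunk to a box with factors [Q1], [Q2], [Q3], one
   for each coordinate. *)
have [[Q12 Q3] /= [[[Q1 Q2] [/= n1 n2] Q12E] n3] QE] := cvgr_neq0 _ Pz0 neq.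
have coord p Q : nbhs (v p) Q -> nbhs x (fun y : CP1N =>
    exists2 w : C * C, Q w /\ w != (0, 0) & y p = hpt w.1 w.2).
  by move=> /nbhs_CP1; exact: (@proj_continuous idx (fun=> CP1 R) p x).
have [y [Fy [[[w1 [Q1w w1_neq0] y1] [w2 [Q2w w2_neq0] y2]]
             [w3 [Q3w w3_neq0] y3]]]] :=
  xcl _ (filterI (filterI (coord _ _ n1) (coord _ _ n2)) (coord _ _ n3)).
have := Fy i j k hij hik hjk; rewrite y1 y2 y3.
rewrite (surjective_pairing w1) in w1_neq0.
rewrite (surjective_pairing w2) in w2_neq0.
rewrite (surjective_pairing w3) in w3_neq0.
have [l1 l1_neq0 [-> ->]] := hxy_hpt w1_neq0.
have [l2 l2_neq0 [-> ->]] := hxy_hpt w2_neq0.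
have [l3 l3_neq0 [-> ->]] := hxy_hpt w3_neq0.
have : P (w1, w2, w3) != 0 by apply: QE; split=> //; exact: Q12E.
(* The chosen coordinates of [y] are multiples of [w1], [w2], [w3], so its equation passes to these
   vectors. *)
move=> /negP + /cocycle_scale h; apply.
by rewrite subr_eq0; apply/eqP; exact: h.
Qed.

End Fnbar.

(** * Monomial curves *)

Section Monomial.
Local Open Scope ring_scope.
Import GRing.Theory Num.Theory.
Import numFieldNormedType.Exports.

(** Truncated differences are positive parts. The three integer differences around a cycle sum to
    zero, so their positive and negative parts have equal sums. This yields the equations of [Fnbar]
    along the approximating curve. *)
Lemma monomial_cocycle (K : comNzRingType) (a b c s : K) (l m r : nat) :
  b * s ^+ (m - l) * (a * s ^+ (l - r)) * (c * s ^+ (r - m)) =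
  a * s ^+ (l - m) * (c * s ^+ (r - l)) * (b * s ^+ (m - r)).
Proof.
transitivity (a * b * c * s ^+ ((m - l) + (l - r) + (r - m))).
  by rewrite !exprD; ring.
have -> : ((m - l) + (l - r) + (r - m) = (l - m) + (r - l) + (m - r))%N by lia.
by rewrite !exprD; ring.
Qed.

Lemma monomial_cvg (K : numFieldType) (a : K) (m : nat) :
  a * s ^+ m @[s --> (0 : K)^'] --> a * 0 ^+ m.
Proof.
apply: cvgM; first exact: cvg_cst.
elim: m => [|m IHm]; first exact: cvg_cst.
under eq_fun do rewrite exprS.
by rewrite exprS; apply: cvgM IHm; exact: nbhs_dnbhs.
Qed.
End Monomial.

(** * The torus orbit *)

Section Orbit.
Local Open Scope ring_scope.
Import GRing.Theory Num.Theory.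
Import numFieldNormedType.Exports.
Variables (R : realType) (n : nat).
Local Notation C := (Cfield R).
Local Notation idx := (idx n).
Local Notation CP1N := (CP1N R n).
Implicit Types (x c : CP1N).

(* The orbit of any point of [Fn]: see [torus_orbitE]. *)
Definition torus_cell : set CP1N := [set x | Fnbar R n x /\
  forall p, x p <> hpt 1 0 /\ x p <> hpt 0 1].

Lemma torus_cellP x : torus_cell x <->
  Fnbar R n x /\ forall p, hx (x p) != 0 /\ hy (x p) != 0.
Proof.
split=> -[Fx xp]; split=> // p; have [h1 h2] := xp p; split.
- by apply: contra_notN h2 => /eqP/hx_eq0.
- by apply: contra_notN h1 => /eqP/hy_eq0.
- by move/hy_eq0/eqP; apply/negP.
- by move/hx_eq0/eqP; apply/negP.
Qed.

Lemma Fn_sub_torus_cell : Fn R n `<=` torus_cell.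
Proof. by move=> x [Fx xp]; split=> // p; have [] := xp p. Qed.

Lemma tcoord_neq0 (t : (n - 3).-tuple C) k :
  torus t -> (3 < k <= n)%N -> tcoord t (k - 3) != 0.
Proof.
(* The coordinate t_(k-3) is entry [k - 4] of the tuple. *)
move=> tt hk; have hk' : ((k - 3).-1 < n - 3)%N by lia.
by have := tt (Ordinal hk'); rewrite (tnth_nth 0).
Qed.

Lemma rho_neq0 (t : (n - 3).-tuple C) p : torus t -> rho t p != 0.
Proof.
move=> tt; case: p => -[i j] /= hij; rewrite /rho /=.
have := ltn_ord i; have := ltn_ord j; move: hij.
rewrite !ltnS => /andP[i3 ij] jn iN.
have tj : tcoord t (j - 3) != 0 by apply: tcoord_neq0 => //; lia.
case: ifP => // /negbT i_neq3.
by rewrite mulf_neq0 // invr_eq0; apply: tcoord_neq0 => //; lia.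
Qed.

(** The weights are quotients t_(j-3) / t_(i-3), with 1 in the denominator when [i] is 3, so they
    telescope. Hence the action preserves the equations of [Fnbar]. *)
Lemma rho_cocycle (t : (n - 3).-tuple C) (i j k : 'I_n.+1)
    (hij : (3 <= i < j)%N) (hik : (3 <= i < k)%N) (hjk : (3 <= j < k)%N) :
  torus t ->
  rho t (Idx hij) * rho t (Idx hjk) = rho t (Idx hik).
Proof.
move=> tt; rewrite /rho /=.
have tj : tcoord t (j - 3) != 0.
  by apply: tcoord_neq0 => //; have := ltn_ord j; lia.
have -> : (j == 3 :> nat) = false by lia.
by case: ifP => _; [rewrite mulrC divfK | rewrite mulrC mulrA divfK].
Qed.

Let q (y : CP1N) p : C := hx (y p) / hy (y p).

(** The affine coordinate x_3k, indexed by a natural number so that a tuple can be built from it.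
    The default 1 keeps it nonzero for every [k]. *)
Let q3 y (k : nat) : C :=
  if insub (inord 3, inord k) is Some p then q y p else 1.

Lemma ratio_neq0 y p : torus_cell y -> q y p != 0.
Proof.
by move=> /torus_cellP[_ /(_ p)[h1 h2]]; rewrite mulf_neq0 // invr_eq0.
Qed.

Lemma ratio3_neq0 y k : torus_cell y -> q3 y k != 0.
Proof.
by move=> Iy; rewrite /q3; case: insubP => *; rewrite ?oner_neq0 ?ratio_neq0.
Qed.

Lemma ratio3E y (i j : 'I_n.+1) (hij : (3 <= i < j)%N) : i = 3%N :> nat ->
  q3 y j = q y (Idx hij).
Proof.
move=> i3; have -> : Idx hij = Sub (i, j) hij by [].
have i3E : inord 3 = i by rewrite -i3 inord_val.
by rewrite /q3 i3E inord_val insubT.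
Qed.

(** This is the equation of [Fnbar] for the triple (3, i, j) divided by nonzero coordinates; it
    recovers every x_ij from the x_3k. *)
Lemma ratio3_cocycle y (i j : 'I_n.+1) (hij : (3 <= i < j)%N) : torus_cell y ->
  (3 < i)%N -> q3 y i * q y (Idx hij) = q3 y j.
Proof.
move=> /torus_cellP[Fy y_neq0] i3.
have i3' : (inord 3 : 'I_n.+1) = 3%N :> nat.
  by apply: inordK; have := ltn_ord i; lia.
have h3i : (3 <= (inord 3 : 'I_n.+1) < i)%N by rewrite i3'; lia.
have h3j : (3 <= (inord 3 : 'I_n.+1) < j)%N by rewrite i3'; lia.
rewrite (ratio3E _ _ _ h3i) // (ratio3E _ _ _ h3j) // /q.
have := Fy _ _ _ h3i h3j hij.
have [_ n1] := y_neq0 (Idx h3i); have [_ n2] := y_neq0 (Idx h3j).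
have [_ n3] := y_neq0 (Idx hij).
move=> h; rewrite mulf_div; apply/eqP.
by rewrite eqr_div ?mulf_neq0 //; apply/eqP; ring: h.
Qed.

Lemma ratio_torus x c : torus_cell x -> torus_cell c ->
  exists2 t, torus t & forall p, rho t p = q x p / q c p.
Proof.
move=> Ix Ic.
(* Entry [m] is t_(m+1), the weight of the coordinate with indices 3 and [m + 4]. *)
pose t : (n - 3).-tuple C :=
  [tuple of mkseq (fun m => q3 x m.+4 / q3 c m.+4) (n - 3)].
have tE (j : 'I_n.+1) : (3 < j)%N -> tcoord t (j - 3) = q3 x j / q3 c j.
  move=> j3; have := ltn_ord j => jn; rewrite /tcoord nth_mkseq; last by lia.
  by have -> : (j - 3).-1.+4 = j by lia.
exists t => [k|[[i j] /= hij]].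
  rewrite (tnth_nth 0) nth_mkseq; last exact: ltn_ord.
  by rewrite mulf_neq0 ?invr_eq0 // ratio3_neq0.
have [qx qc] : q x (Idx hij) != 0 /\ q c (Idx hij) != 0.
  by split; exact: ratio_neq0.
have -> : exist _ (i, j) hij = Idx hij by [].
rewrite /rho /= tE; last by lia.
have [i3|i3] := eqVneq (i : nat) 3%N; first by rewrite !(ratio3E _ _ _ hij).
rewrite tE; last by lia.
(* Once x_3j is written as x_3i x_ij, for [x] and for [c], the factors with index 3i cancel. *)
rewrite -!(ratio3_cocycle _ _ _ hij) //; try lia.
have x3 := ratio3_neq0 x i Ix; have c3 := ratio3_neq0 c i Ic.
rewrite -[q3 x i * _ / _]mulf_div.
by rewrite mulrAC divff ?mul1r // mulf_neq0 // invr_eq0.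
Qed.

Lemma torus_orbitE c : torus_cell c -> torus_orbit c = torus_cell.
Proof.
move=> Ic; have /torus_cellP[Fc c_neq0] := Ic.
apply/seteqP; split=> [_ [t tt <-]|x Ix].
  have fg p : (rho t p * hx (c p), hy (c p)) != (0, 0).
    by rewrite xpair_eqE negb_and (c_neq0 p).2 orbT.
  split; last first.
    move=> p; have [cx cy] := c_neq0 p; rewrite /torus_act /scaleP1.
    split=> [/hy_eq0|/hx_eq0]; have [l l0 [ex ey]] := hxy_hpt (fg p).
      by apply/eqP; rewrite ey mulf_neq0.
    by apply/eqP; rewrite ex !mulf_neq0 // rho_neq0.
  (* On the scaled representatives both sides of an equation acquire the factor rho_ij rho_jk. *)
  apply/(Fnbar_hpt _ _ _ _ _ fg) => // i j k hij hik hjk.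
  rewrite -(rho_cocycle _ _ _ _ hij hik hjk tt).
  have := Fc i j k hij hik hjk.
  set rij := rho _ _; set rjk := rho _ _.
  set a := hx _; set b := hy _; set d := hx _.
  set e := hy _; set f := hx _; set g := hy _.
  by move=> h; ring: h.
have /torus_cellP[Fx x_neq0] := Ix.
have [t tt tE] := ratio_torus x c Ix Ic; exists t => //.
apply/funext => p; have [x1 x2] := x_neq0 p; have [c1 c2] := c_neq0 p.
rewrite /torus_act /scaleP1; apply/hpt_hx.
  by rewrite xpair_eqE negb_and c2 orbT.
by rewrite tE /q; field; rewrite x2 c1 c2.
Qed.

(** * Density of the orbit *)

Lemma Fnbar_approx x : Fnbar R n x ->
  exists2 y : C -> CP1N, (forall s, s != 0 -> torus_cell (y s)) &
    y s @[s --> (0 : C)^'] --> x.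
Proof.
move=> Fx; pose I : finType := {i : 'I_n.+1 | (3 <= i)%N}.
(* [(A i j : A j i)] is the coordinate [c_ij], with [A j i] in the place of
   [c'_ij]; in this form the equations of [Fnbar] are cyclic and hold for all
   triples of indices. *)
pose A (i j : I) : C := if insub (val i, val j) is Some p then hx (x p)
  else if insub (val j, val i) is Some p then hy (x p) else 1.
have A_lt (i j : I) (h : (3 <= val i < val j)%N) : A i j = hx (x (Idx h)).
  by rewrite /A insubT.
have A_gt (i j : I) (h : (3 <= val i < val j)%N) : A j i = hy (x (Idx h)).
  rewrite /A insubF; first by rewrite insubT.
  by case/andP: h => _ /ltnW; rewrite leqNgt => /negbTE /= ->; rewrite andbF.
have A_eq (i : I) : A i i = 1 by rewrite /A insubF //= ltnn andbF.
have A_neq0 i j : (A i j != 0) || (A j i != 0).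
  have lt (i' j' : I) : (val i' < val j')%N -> (A i' j' != 0) || (A j' i' != 0).
    move=> ij; have h : (3 <= val i' < val j')%N by rewrite (valP i').
    by rewrite (A_lt _ _ h) (A_gt _ _ h) -negb_and -xpair_eqE hxy_neq0.
  have [ij|ij|/val_inj/val_inj ->] := ltngtP (val i) (val j).
  - exact: lt.
  - by rewrite orbC lt.
  - by rewrite A_eq oner_neq0.
(* [P] is invariant under rotation and reversal of its arguments, so distinct indices may be taken
   in increasing order; with a repeated index it is trivial. *)
pose P i j k := A i j * A j k * A k i = A j i * A k j * A i k.
have P_rot i j k : P i j k -> P j k i.
  by rewrite /P => h; rewrite mulrC mulrA h -mulrA mulrC.
have P_rev i j k : P i j k -> P k j i.
  by rewrite /P => h; rewrite [A k j * _]mulrC -h [A i j * _]mulrC.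
have P_lt (i j k : I) : (val i < val j)%N -> (val j < val k)%N -> P i j k.
  move=> ij jk; rewrite /P.
  have hij : (3 <= val i < val j)%N by rewrite (valP i).
  have hjk : (3 <= val j < val k)%N by rewrite (valP j).
  have hik : (3 <= val i < val k)%N by rewrite (valP i) (ltn_trans ij).
  rewrite !(A_lt _ _ hij, A_lt _ _ hik, A_lt _ _ hjk).
  rewrite !(A_gt _ _ hij, A_gt _ _ hik, A_gt _ _ hjk).
  by rewrite mulrAC [RHS]mulrAC; exact: Fx.
have A_cocycle (i j k : I) : P i j k.
  have [ij|ij|/val_inj/val_inj <-] := ltngtP (val i) (val j); last first.
  - by rewrite /P -!mulrA [A i k * _]mulrC.
  - have [jk|kj|/val_inj/val_inj <-] := ltngtP (val j) (val k); last first.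
    + by rewrite /P -[LHS]mulrA [A j j * _]mulrC [RHS]mulrC.
    + exact/P_rev/P_lt.
    + have [ik|ki|/val_inj/val_inj <-] := ltngtP (val i) (val k); last first.
      * by rewrite /P [A i j * _]mulrC.
      * exact/P_rot/P_rot/P_lt.
      * exact/P_rev/P_rot/P_rot/P_lt.
  - have [jk|kj|/val_inj/val_inj <-] := ltngtP (val j) (val k); last first.
    + by rewrite /P -[LHS]mulrA [A j j * _]mulrC [RHS]mulrC.
    + have [ik|ki|/val_inj/val_inj <-] := ltngtP (val i) (val k); last first.
      * by rewrite /P [A i j * _]mulrC.
      * exact/P_rot/P_lt.
      * exact/P_rev/P_rot/P_lt.
    + exact: P_lt.
have [l [a [a_neq0 lE]]] := cocycle_levels _ _ _ A_neq0 A_cocycle.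
pose lo (p : idx) : I := Sub (val p).1 (proj1 (andP (valP p))).
have hi3 (p : idx) : (3 <= (val p).2)%N.
  by have /andP[p3 /ltnW] := valP p; exact: leq_trans.
pose hi (p : idx) : I := Sub (val p).2 (hi3 p).
(* Numerator and denominator of the curve after a common power of [s] is cancelled: truncation makes
   one exponent 0, so the pair is nonzero even at [s = 0]. *)
pose f p (s : C) := a (hi p) * s ^+ (l (hi p) - l (lo p)).
pose g p (s : C) := a (lo p) * s ^+ (l (lo p) - l (hi p)).
have fg_neq0 p s : (f p s, g p s) != (0, 0).
  rewrite xpair_eqE /f /g !mulf_eq0 !(negPf (a_neq0 _)) /= !expf_eq0 !subn_gt0.
  by case: (ltngtP (l (lo p)) (l (hi p))); rewrite ?andbF.
(* At [s = 0] the cross product is exactly the identity of [cocycle_levels]. *)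
have xE p : x p = hpt (f p 0) (g p 0).
  apply/esym/hpt_hx => //.
  have h : (3 <= val (lo p) < val (hi p))%N by exact: valP p.
  have pE : Idx h = p by apply: val_inj; rewrite [RHS]surjective_pairing.
  have := lE (lo p) (hi p); rewrite (A_lt _ _ h) (A_gt _ _ h) pE.
  by move=> e; rewrite mulrC -e mulrC.
pose y s : CP1N := fun p => hpt (f p s) (g p s).
exists y => [s s_neq0|].
  split.
    apply/(Fnbar_hpt _ _ _ (f ^~ s) (g ^~ s)) => // i j k hij hik hjk.
    rewrite /f /g.
    have -> : lo (Idx hik) = lo (Idx hij) by exact: val_inj.
    have -> : lo (Idx hjk) = hi (Idx hij) by exact: val_inj.
    have -> : hi (Idx hjk) = hi (Idx hik) by exact: val_inj.
    exact: monomial_cocycle.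
  move=> p; split=> [/hy_eq0|/hx_eq0] /eqP; rewrite /y;
    have [m m_neq0 [ex ey]] := hxy_hpt (fg_neq0 p s); apply/negP;
    by rewrite ?ex ?ey !mulf_neq0 // expf_neq0.
apply: cvg_prod_topology => p; rewrite xE.
apply: hpt_cvg; rewrite ?fg_neq0 //; exact: monomial_cvg.
Qed.

Lemma closure_torus_cell : closure torus_cell = Fnbar R n.
Proof.
apply/seteqP; split=> [|x Fx].
  rewrite (closure_id (Fnbar R n)).1; last exact: closed_Fnbar.
  by apply: closureS => x [].
have [y Iy yx] := Fnbar_approx _ Fx.
(* The punctured neighbourhood filter at 0 is proper, so some nonzero [s] puts [y s] in [B]. *)
move=> B /yx nB; have [s [sB s0]] :=
  filter_ex (filterI (F := (0 : C)^') nB (nbhs_dnbhs_neq (0 : C))).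
by exists (y s); split=> //; exact: Iy.
Qed.

End Orbit.

(** * Strata and the two classes of outgrows *)

Section Outgrows.
Local Open Scope ring_scope.
Variables (R : realType) (n : nat).
Local Notation CP1N := (CP1N R n).
Implicit Types (x y : CP1N) (S : set CP1N).
Local Notation torus_cell := (torus_cell R n).

(** The unique stratum containing a point [x] of [Fnbar]. *)
Let own x : set CP1N := stratum [set p | x p = hpt 1 0]
  [set p | x p = hpt 0 1] [set p | x p = hpt 1 1].

(** Membership in a stratum fixes where each special value occurs. Equalities of propositions allow
    rewriting, which shows that [torus_cell] and [Fn] are unions of strata. *)
Lemma stratum_coords A10 A01 A11 x y p :
  stratum A10 A01 A11 x -> stratum A10 A01 A11 y ->
  [/\ (x p = hpt 1 0) = (y p = hpt 1 0), (x p = hpt 0 1) = (y p = hpt 0 1) &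
      (x p = hpt 1 1) = (y p = hpt 1 1)].
Proof.
move=> [_ [<- <- <-]] [_ [e10 e01 e11]]; split.
- by move/(congr1 (@^~ p)): e10.
- by move/(congr1 (@^~ p)): e01.
- by move/(congr1 (@^~ p)): e11.
Qed.

Lemma stratum_torus_cell A10 A01 A11 x y :
  stratum A10 A01 A11 x -> stratum A10 A01 A11 y ->
  torus_cell x -> torus_cell y.
Proof.
move=> sx sy [_ Ix]; split=> [|p]; first by case: sy.
by have [<- <- _] := stratum_coords _ _ _ _ _ p sx sy; exact: Ix.
Qed.

Lemma stratum_Fn A10 A01 A11 x y :
  stratum A10 A01 A11 x -> stratum A10 A01 A11 y -> Fn R n x -> Fn R n y.
Proof.
move=> sx sy [_ Ix]; split=> [|p]; first by case: sy.
by have [<- <- <-] := stratum_coords _ _ _ _ _ p sx sy; exact: Ix.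
Qed.

Lemma exists_outgrow x : Fnbar R n x -> ~ Fn R n x ->
  exists A10 A01 A11,
    outgrows R n (stratum A10 A01 A11) /\ stratum A10 A01 A11 x.
Proof.
move=> Fx nFx; exists [set p | x p = hpt 1 0], [set p | x p = hpt 0 1],
  [set p | x p = hpt 1 1].
have ox : own x x by [].
split=> //; split; [by do 3 eexists|by exists x|move=> y oy; split].
  by case: oy.
by move=> Fy; apply: nFx; exact: stratum_Fn oy ox Fy.
Qed.

Lemma bigcup_outgrows_torus_cell :
  \bigcup_(S in [set S | outgrows R n S /\ S `<=` torus_cell]) S =
  torus_cell `\` Fn R n.
Proof.
apply/seteqP; split=> [x [S [[_ _ SF] SI] Sx]|x [Ix nFx]].
  by split; [exact: SI|have [] := SF _ Sx].
have [A10 [A01 [A11 [oS Sx]]]] := exists_outgrow _ Ix.1 nFx.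
exists (stratum A10 A01 A11) => //; split=> // y Sy.
exact: stratum_torus_cell Sx Sy Ix.
Qed.

Lemma bigcup_outgrows_boundary :
  \bigcup_(S in [set S | outgrows R n S /\ S `<=` ~` torus_cell]) S =
  Fnbar R n `\` torus_cell.
Proof.
apply/seteqP; split=> [x [S [[_ _ SF] SI] Sx]|x [Fx nIx]].
  by split; [have [] := SF _ Sx|exact: SI].
have nFx : ~ Fn R n x by move=> /Fn_sub_torus_cell.
have [A10 [A01 [A11 [oS Sx]]]] := exists_outgrow _ Fx nFx.
exists (stratum A10 A01 A11) => //; split=> // y Sy Iy.
by apply: nIx; exact: stratum_torus_cell Sy Sx Iy.
Qed.

(** A single point decides the side, since its whole stratum follows it. *)
Lemma outgrows_split S : outgrows R n S ->
  S `<=` torus_cell \/ S `<=` ~` torus_cell.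
Proof.
move=> [[A10 [A01 [A11 ->]]] [x Sx] _].
have [Ix|nIx] := pselect (torus_cell x); [left|right] => y Sy.
  exact: stratum_torus_cell Sx Sy Ix.
by move=> Iy; apply: nIx; exact: stratum_torus_cell Sy Sx Iy.
Qed.

Lemma torus_cell_diff_Fn : torus_cell `\` Fn R n =
  [set x | Fnbar R n x /\ (exists p, x p = hpt 1 1) /\
     (forall p, x p <> hpt 1 0 /\ x p <> hpt 0 1)].
Proof.
apply/seteqP; split=> [x [[Fx Ix] nFx]|x [Fx [[p xp] Ix]]].
  split=> //; split=> //; apply/not_existsP => x1; apply: nFx; split=> // p.
  by have [] := Ix p; split.
by split=> // -[_ /(_ p)[]].
Qed.

Lemma Fnbar_diff_torus_cell : Fnbar R n `\` torus_cell =
  [set x | Fnbar R n x /\ (exists p, x p = hpt 1 0 \/ x p = hpt 0 1)].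
Proof.
apply/seteqP; split=> [x [Fx nIx]|x [Fx [p xp]]].
  split=> //; apply: contrapT => /forallNP x01; apply: nIx; split=> // p.
  by split=> e; apply: (x01 p); [left|right].
by split=> // -[_ /(_ p)[x10 x01]]; case: xp.
Qed.
End Outgrows.

Theorem proposition12 (R : realType) (n : nat) (hn : (4 <= n)%N) :
  exists O1 O2 : set (set (CP1N R n)),
  [/\ O1 `|` O2 = outgrows R n,
      O1 `&` O2 = set0,
      (forall c : CP1N R n, Fn R n c ->
         Fn R n `<=` torus_orbit c /\ torus_orbit c `\` Fn R n = \bigcup_(S in O1) S) /\
      \bigcup_(S in O1) S =
        [set x : CP1N R n | Fnbar R n x /\ (exists p, x p = hpt 1 1) /\
           (forall p, x p <> hpt 1 0 /\ x p <> hpt 0 1)]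
    & (forall c : CP1N R n, Fn R n c ->
         [/\ torus_orbit c `<=` Fnbar R n,
             closure (torus_orbit c) = Fnbar R n &
             Fnbar R n `\` torus_orbit c = \bigcup_(S in O2) S]) /\
      \bigcup_(S in O2) S =
        [set x : CP1N R n | Fnbar R n x /\
           (exists p, x p = hpt 1 0 \/ x p = hpt 0 1)]].
Proof.
(* The classes do not depend on [c]: all points of [Fn] have the same orbit, [torus_cell]. *)
exists [set S | outgrows R n S /\ S `<=` torus_cell R n],
  [set S | outgrows R n S /\ S `<=` ~` torus_cell R n].
rewrite bigcup_outgrows_torus_cell bigcup_outgrows_boundary.
split.
- apply/seteqP; split=> [S [[]|[]]|S oS] //.
  by have [SI|SI] := outgrows_split _ _ _ oS; [left|right].
(* Disjointness rests on outgrows being nonempty: the empty set would lie in both classes. *)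
- apply/seteqP; split=> // S [[[_ [x Sx] _] SI] [_ SnI]].
  exact: SnI Sx (SI _ Sx).
- split; last exact: torus_cell_diff_Fn.
  move=> c /Fn_sub_torus_cell Ic; rewrite (torus_orbitE _ _ _ Ic).
  by split=> //; exact: Fn_sub_torus_cell.
- split; last exact: Fnbar_diff_torus_cell.
  move=> c /Fn_sub_torus_cell Ic; rewrite (torus_orbitE _ _ _ Ic); split=> //.
    by move=> x [].
  exact: closure_torus_cell.
Qed.
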